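(* Let $G$ be a cyclic group of order $m=p_1p_2\cdots p_r$ where $p_1<p_2<\cdots<p_r$ are primes and $r\ge 2$. Let $z$ be a generator of $G$, $\zeta$ a primitive $m$-th root of unity in $\mathbb{C}$, and $\varphi:\mathbb{Z}G\to\mathbb{Z}[\zeta]$ the ring homomorphism with $\varphi(z)=\zeta$. Let $x,y\in\mathbb{N}G$ satisfy $\varphi(x)=\varphi(y)$. If $\varepsilon_0(x)\le p_1-1$, then either (A) $y\ge x$, or (B) $\varepsilon_0(y)\ge (p_1-\varepsilon_0(x))(p_2-1)$. Moreover, in case (A) we have $\varepsilon_0(y)\ge\varepsilon_0(x)$, and in case (B) we have $\varepsilon_0(y)>\varepsilon_0(x)$.
   Context: $\mathbb{N}=\{0,1,2,\dots\}$ and $\mathbb{N}G$ is the set of elements $\sum_{g\in G}x_gg$ of the integral group ring $\mathbb{Z}G$ with all $x_g\ge0$. For $x=\sum x_gg\in\mathbb{Z}G$, $\varepsilon_0(x)$ is the number of $g$ with $x_g\ne0$. The partial order on $\mathbb{Z}G$ is: $y=\sum y_gg\ge x=\sum x_gg$ iff $y_g\ge x_g$ for every $g\in G$. *)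

(* Defs.v *)
From HB Require Import structures.
From mathcomp Require Import all_boot all_order all_algebra all_fingroup.
From mathcomp Require Import all_solvable reals complex.

Set Implicit Arguments.
Unset Strict Implicit.
Unset Printing Implicit Defensive.

Import Order.TTheory GRing.Theory Num.Theory.
Local Open Scope ring_scope.

(* The integral group ring Z[gT], an element being its family of coefficients.
   The alias keeps the convolution product apart from the pointwise product
   that {ffun gT -> int} already carries. *)
Definition int_gring (gT : finGroupType) : Type := {ffun gT -> int}.

HB.instance Definition _ (gT : finGroupType) :=
  GRing.Zmodule.copy (int_gring gT) {ffun gT -> int}.

Section IntGroupRing.

Variable gT : finGroupType.
Implicit Types (x y : int_gring gT) (g h : gT).

Definition gr_coef x g : int := (x : {ffun gT -> int}) g.

Definition gr_elt g : int_gring gT := [ffun h => ((h == g)%:R : int)].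

Definition gr_mul x y : int_gring gT :=
  [ffun g => \sum_(h : gT) gr_coef x h * gr_coef y (h^-1 * g)%g].

Lemma gr_coefP x y : (forall g, gr_coef x g = gr_coef y g) -> x = y.
Proof. by move=> exy; apply/ffunP. Qed.

Lemma gr_coefD x y g : gr_coef (x + y) g = gr_coef x g + gr_coef y g.
Proof. by rewrite /gr_coef ffunE. Qed.

Lemma gr_coef_elt g h : gr_coef (gr_elt g) h = (h == g)%:R.
Proof. by rewrite /gr_coef ffunE. Qed.

Lemma gr_coef_mul x y g :
  gr_coef (gr_mul x y) g = \sum_(h : gT) gr_coef x h * gr_coef y (h^-1 * g)%g.
Proof. by rewrite {1}/gr_coef ffunE. Qed.

Fact gr_mulA : associative gr_mul.
Proof.
move=> x y w; apply: gr_coefP => g; rewrite !gr_coef_mul.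
under eq_bigr => h _ do rewrite gr_coef_mul mulr_sumr.
under [RHS]eq_bigr => k _ do rewrite gr_coef_mul mulr_suml.
rewrite [RHS]exchange_big /=; apply: eq_bigr => h _.
rewrite [RHS](reindex_inj (mulgI h)) /=; apply: eq_bigr => k _.
by rewrite mulKg invMg mulgA mulrA.
Qed.

Fact gr_mul1l : left_id (gr_elt 1%g) gr_mul.
Proof.
move=> x; apply: gr_coefP => g; rewrite gr_coef_mul (bigD1 1%g) //=.
rewrite gr_coef_elt eqxx mul1r invg1 mul1g big1 ?addr0 // => h /negPf h1.
by rewrite gr_coef_elt h1 mul0r.
Qed.

Fact gr_mul1r : right_id (gr_elt 1%g) gr_mul.
Proof.
move=> x; apply: gr_coefP => g; rewrite gr_coef_mul (bigD1 g) //=.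
rewrite gr_coef_elt mulVg eqxx mulr1 big1 ?addr0 // => h hg.
by rewrite gr_coef_elt -eq_mulVg1 (negPf hg) mulr0.
Qed.

Fact gr_mulDl : left_distributive gr_mul +%R.
Proof.
move=> x y w; apply: gr_coefP => g; rewrite gr_coefD !gr_coef_mul -big_split /=.
by apply: eq_bigr => h _; rewrite gr_coefD mulrDl.
Qed.

Fact gr_mulDr : right_distributive gr_mul +%R.
Proof.
move=> x y w; apply: gr_coefP => g; rewrite gr_coefD !gr_coef_mul -big_split /=.
by apply: eq_bigr => h _; rewrite gr_coefD mulrDr.
Qed.

Fact gr_one_neq0 : gr_elt 1%g != 0 :> int_gring gT.
Proof.
apply/eqP => /(congr1 (fun x => gr_coef x 1%g)).
by rewrite gr_coef_elt eqxx /gr_coef ffunE.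
Qed.

HB.instance Definition _ := GRing.Zmodule_isNzRing.Build (int_gring gT)
  gr_mulA gr_mul1l gr_mul1r gr_mulDl gr_mulDr gr_one_neq0.

(* The subset NG of the group ring. *)
Definition gr_nat x : Prop := forall g, 0 <= gr_coef x g.

Definition gr_le x y : Prop := forall g, gr_coef x g <= gr_coef y g.

Definition gr_eps0 x : nat := #|[set g : gT | gr_coef x g != 0]|.

End IntGroupRing.

(* Main.v *)
(* Peel off the primes p > p1 one at a time, keeping the group of order p1 for
   the end.  With m = p * n and p prime to n, split x and y into p rows x_i, y_i
   over Z/n.  Conjugating the relation phi (x - y) = 0 by the automorphisms
   fixing the n-th roots of unity and inverting a Fourier transform over Z/p
   shows that phi (x_i - y_i) does not depend on i.  Some row x_j vanishes since
   x has fewer than p1 nonzero coefficients; choose it with the support of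
   w := y_j minimal, of size k.  Then phi (x_i + w) = phi y_i for all i.  If all
   the x_i + w have small support and satisfy y_i >= x_i + w, then y >= x.
   Otherwise, with e the size of the support of x_i for an offending i, either
   the induction hypothesis makes the support of y_i large or k >= p1 - e; as
   every other row of y over a vanishing row of x has a support of size at least
   k, this gives the lower bound on the support of y. *)
Require Import Defs.
From mathcomp Require Import all_boot all_order all_algebra all_fingroup.
From mathcomp Require Import all_solvable all_field reals complex.
From mathcomp Require Import zify.
Import Order.TTheory GRing.Theory Num.Theory.
Local Open Scope ring_scope.
Set Implicit Arguments.
Unset Strict Implicit.

(** * Cyclotomic polynomials and conjugation of vanishing sums *)

Lemma root_Cyclotomic (F : numFieldType) n (z : F) :
  n.-primitive_root z -> root (map_poly intr 'Phi_n) z.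
Proof.
move=> zP; have n_gt0 := prim_order_gt0 zP.
have := congr1 (map_poly (intr : int -> F)) (prod_Cyclotomic n_gt0).
rewrite rmorph_prod rmorphB rmorph1 /= map_polyXn => eqX.
have := congr1 (fun q => q.[z]) eqX.
rewrite !hornerE prim_expr_order // subrr horner_prod => /eqP.
(* Some ['Phi_d] with [d] dividing [n] vanishes at [z]; then [z ^+ d = 1], which forces [d = n]. *)
rewrite prodf_seq_eq0 => /hasP[d d_n /= rd].
have dn : (d %| n)%N by rewrite -dvdn_divisors in d_n.
have d_gt0 : (0 < d)%N by apply: dvdn_gt0 dn.
have := congr1 (map_poly (intr : int -> F)) (prod_Cyclotomic d_gt0).
rewrite (big_rem d) /= -?dvdn_divisors // rmorphM rmorphB rmorph1 /= map_polyXn => eqd.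
have : root ('X^d - 1) z by rewrite -eqd rootM /root rd.
rewrite rootE !hornerE subr_eq0 -(prim_order_dvd zP) => nd.
by have /eqP <- : (d == n)%N by rewrite eqn_dvd dn nd.
Qed.

(* A root in algC of gcd(Phi_n, P) is a primitive n-th root, hence has minimal polynomial Phi_n. *)
Lemma Cyclotomic_dvdp (F : numFieldType) n (z : F) (P : {poly rat}) :
  n.-primitive_root z -> root (map_poly ratr P) z -> map_poly intr 'Phi_n %| P.
Proof.
move=> zP Pz0; have n_gt0 := prim_order_gt0 zP.
set Phi : {poly rat} := map_poly intr 'Phi_n.
have ratrPhi (K : numFieldType) :
    map_poly (ratr : rat -> K) Phi = map_poly intr 'Phi_n.
  by rewrite -map_poly_comp; apply: eq_map_poly => a /=; rewrite ratr_int.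
set g := gcdp Phi P.
(* Were the gcd constant over [rat], it would stay so over [F], where [z] is a common root. *)
have [w wg] : exists w : algC, root (map_poly ratr g) w.
  apply/closed_rootP; rewrite size_map_poly -/(coprimep Phi P).
  apply/negP; rewrite -(coprimep_map (ratr : rat -> F)) => /coprimep_root.
  by move=> /(_ z); rewrite ratrPhi => /(_ (root_Cyclotomic zP)); rewrite -rootE Pz0.
have wPhi : root (map_poly ratr Phi) w.
  by apply: (root_dvdp _ wg); rewrite dvdp_map dvdp_gcdl.
have [v vP] := C_prim_root_exists n_gt0.
have wP : n.-primitive_root w.
  by rewrite -(root_cyclotomic vP) -(Cintr_Cyclotomic vP) -ratrPhi.
have [f [Df _ dvf]] := minCpolyP w.
have -> : Phi = f.
  apply: (map_poly_inj (ratr : {rmorphism rat -> algC})).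
  by rewrite -Df (minCpoly_cyclotomic wP) ratrPhi (Cintr_Cyclotomic wP).
by rewrite -dvf; apply: (root_dvdp _ wg); rewrite dvdp_map dvdp_gcdr.
Qed.

(** A rational polynomial vanishing at [z] is a multiple of ['Phi_n], hence vanishes at [z ^+ k];
    this stands in for an automorphism of the cyclotomic field. *)
Lemma sum_prim_root_conj (F : numFieldType) n (z : F) k (d : nat -> int) :
    n.-primitive_root z -> coprime k n ->
    \sum_(a < n) (d a)%:~R * z ^+ a = 0 ->
  \sum_(a < n) (d a)%:~R * (z ^+ k) ^+ a = 0.
Proof.
move=> zP co_kn sum0.
pose P : {poly rat} := \sum_(a < n) (d a)%:~R%:P * 'X^a.
have PE (u : F) : (map_poly ratr P).[u] = \sum_(a < n) (d a)%:~R * u ^+ a.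
  rewrite rmorph_sum horner_sum; apply: eq_bigr => a _.
  by rewrite rmorphM /= map_polyC map_polyXn hornerCM hornerXn /= ratr_int.
rewrite -PE; have /dvdpP[Q ->] : map_poly intr 'Phi_n %| P.
  by apply: (Cyclotomic_dvdp zP); rewrite rootE PE sum0.
rewrite rmorphM hornerM /= -map_poly_comp (eq_map_poly (ratr_int F)).
have : root (map_poly intr 'Phi_n) (z ^+ k).
  by apply: root_Cyclotomic; rewrite prim_root_exp_coprime.
by rewrite rootE => /eqP ->; rewrite mulr0.
Qed.

(** * Chinese remainder indexing by [p] rows of length [n] *)

Lemma coprime_modMr_inj d n i j : coprime d n -> (i < d)%N -> (j < d)%N ->
  (i * n = j * n %[mod d])%N -> i = j.
Proof.
move=> co_dn; wlog ji : i j / (j <= i)%N.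
  move=> IH id jd e; case/orP: (leq_total j i) => ij; first exact: IH.
  by symmetry; apply: IH.
move=> id jd /eqP; rewrite eqn_mod_dvd ?leq_mul2r ?ji ?orbT // -mulnBl.
rewrite Gauss_dvdl // => /dvdn_leq ij; apply/eqP; rewrite eqn_leq ji andbT.
rewrite -subn_eq0; apply: contraLR id => ne; rewrite -leqNgt.
by rewrite (leq_trans (ij _)) ?lt0n // leq_subr.
Qed.

(* The exponent of z in (z ^+ n) ^+ i * (z ^+ p) ^+ b when z has order p * n. *)
Definition crt_index p n i b := ((i * n + b * p) %% (p * n))%N.

Lemma crt_index_inj p n i j b c : coprime p n ->
    (i < p)%N -> (j < p)%N -> (b < n)%N -> (c < n)%N ->
  crt_index p n i b = crt_index p n j c -> i = j /\ b = c.
Proof.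
move=> co_pn ip jp bn cn e.
have ed d : (d %| p * n -> i * n + b * p = j * n + c * p %[mod d])%N.
  by move=> dpn; rewrite -(modn_dvdm _ dpn) -/(crt_index p n i b) e modn_dvdm.
split.
  apply: (coprime_modMr_inj co_pn ip jp).
  by have := ed p (dvdn_mulr n (dvdnn p)); rewrite ![(_ + _ * p)%N]addnC !modnMDl.
apply: (@coprime_modMr_inj n p); rewrite 1?coprime_sym //.
by have := ed n (dvdn_mull p (dvdnn n)); rewrite !modnMDl.
Qed.

Lemma crt_index_bij p n (ltP : forall i b, (i < p)%N -> (b < n)%N ->
    (crt_index p n i b < p * n)%N) : coprime p n ->
  bijective (fun u : 'I_p * 'I_n => Ordinal (ltP u.1 u.2 (ltn_ord u.1) (ltn_ord u.2))).
Proof.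
move=> co_pn; apply: inj_card_bij; last by rewrite card_prod !card_ord.
move=> [i b] [j c] /(congr1 val) /= /(crt_index_inj co_pn).
by case=> // /val_inj -> /val_inj ->.
Qed.

Lemma ltn_crt_index p n i b : (i < p)%N -> (b < n)%N ->
  (crt_index p n i b < p * n)%N.
Proof. by move=> ip bn; rewrite ltn_mod muln_gt0 (leq_trans _ ip) ?(leq_trans _ bn). Qed.

Lemma big_crt_index (S : Type) (idx : S) (op : Monoid.com_law idx) p n (f : nat -> S) :
    coprime p n ->
  \big[op/idx]_(a < p * n) f a =
    \big[op/idx]_(i < p) \big[op/idx]_(b < n) f (crt_index p n i b).
Proof.
move=> co_pn; rewrite pair_big.
have /onW_bij h := crt_index_bij (@ltn_crt_index p n) co_pn.
by rewrite (reindex _ (h _)).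
Qed.

Lemma crt_index_surj p n a : coprime p n -> (a < p * n)%N ->
  exists i b, [/\ (i < p)%N, (b < n)%N & a = crt_index p n i b].
Proof.
move=> co_pn an; have [g _ gK] := crt_index_bij (@ltn_crt_index p n) co_pn.
exists (g (Ordinal an)).1, (g (Ordinal an)).2; split=> //.
by have /(congr1 val) := gK (Ordinal an).
Qed.

(** * Fourier inversion over the rows *)

Lemma sum_expr_unity (F : fieldType) p (v : F) :
  v ^+ p = 1 -> v != 1 -> \sum_(j < p) v ^+ j = 0.
Proof.
move=> vp v1; apply/eqP; have /eqP := subrX1 v p.
by rewrite vp subrr eq_sym mulf_eq0 subr_eq0 (negPf v1).
Qed.

(* Finite Fourier inversion on Z/p: the conjugates of the relation kill every
   Fourier coefficient of A except the one of frequency 0. *)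
Lemma row_sum_const (F : numFieldType) p n (z : F) (d : nat -> int)
    (A := fun i : nat => \sum_(b < n) (d (crt_index p n i b))%:~R * (z ^+ p) ^+ b) l :
    prime p -> coprime p n -> (p * n).-primitive_root z ->
    \sum_(a < p * n) (d a)%:~R * z ^+ a = 0 -> (l < p)%N ->
  p%:R * A l = \sum_(i < p) A i.
Proof.
move=> p_pr co_pn zP sum0 lp.
have p_gt0 := prime_gt0 p_pr.
have z_pn := prim_expr_order zP.
set w := z ^+ n.
have wp : w ^+ p = 1 by rewrite -exprM mulnC.
have wP : p.-primitive_root w.
  by rewrite /w -{1}(mulKn n p_gt0) dvdn_prim_root ?dvdn_mulr.
pose B j := \sum_(i < p) (w ^+ j) ^+ i * A i.
have B0 j : (0 < j < p)%N -> B j = 0.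
  (* This [k] makes [z |-> z ^+ k] fix [z ^+ p] and send [w] to [w ^+ j], so the conjugate relation
     reads [B j = 0]. *)
  case/andP=> j_gt0 jp; pose k := chinese p n j 1.
  have kp : (k = j %[mod p])%N by apply: chinese_modl.
  have kn : (k = 1 %[mod n])%N by apply: chinese_modr.
  have co_k : coprime k (p * n).
    rewrite coprimeMr -coprime_modl kp -[in X in _ && X]coprime_modl kn !coprime_modl.
    by rewrite coprime1n andbT coprime_sym prime_coprime // gtnNdvd.
  rewrite -(sum_prim_root_conj zP co_k sum0).
  rewrite (big_crt_index _ (fun a => (d a)%:~R * (z ^+ k) ^+ a) co_pn).
  apply: eq_bigr => i _; rewrite mulr_sumr; apply: eq_bigr => b _.
  rewrite mulrCA; congr (_ * _); rewrite -exprM mulnC exprM.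
  rewrite [RHS]exprAC (prim_expr_mod zP) exprD exprMn.
  congr (_ * _).
    rewrite mulnC exprM -/w -!exprM ![(i * _)%N]mulnC !exprM.
    by rewrite -(expr_mod k wp) kp expr_mod.
  rewrite mulnC -!exprM -[(p * b * k)%N]mulnA [(b * k)%N]mulnC mulnA exprM.
  rewrite [in RHS]exprM; congr (_ ^+ b).
  have zpn : (z ^+ p) ^+ n = 1 by rewrite -exprM.
  by rewrite exprM -(expr_mod k zpn) kn expr_mod ?expr1.
(* [w ^+ (p - l)] is the inverse of [w ^+ l]: the right side is an inverse Fourier transform, of
   which only the term [j = 0] survives. *)
have -> : \sum_(i < p) A i = \sum_(j < p) (w ^+ (p - l)) ^+ j * B j.
  rewrite [RHS](bigD1 (Ordinal p_gt0)) //= expr0 mul1r [X in _ + X]big1 ?addr0.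
    by apply: eq_bigr => i _; rewrite expr0 expr1n mul1r.
  move=> j /eqP j0; rewrite B0 ?mulr0 // ltn_ord andbT lt0n.
  by apply/eqP => j0'; apply: j0; apply: val_inj.
under [RHS]eq_bigr do rewrite mulr_sumr.
have Fourier i : \sum_(j < p) (w ^+ (p - l)) ^+ j * ((w ^+ j) ^+ i * A i) =
    (\sum_(j < p) (w ^+ (p - l + i)) ^+ j) * A i.
  rewrite mulr_suml; apply: eq_bigr => j _.
  by rewrite mulrA [(w ^+ j) ^+ i]exprAC -exprMn -exprD.
rewrite exchange_big /=; under [RHS]eq_bigr do rewrite Fourier.
(* The geometric sum is [p] at [i = l] and zero at every other [i]. *)
rewrite (bigD1 (Ordinal lp)) //= [X in _ + X]big1 ?addr0.
  rewrite subnK ?(ltnW lp) // wp.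
  congr (_ * _); under [RHS]eq_bigr do rewrite expr1n.
  by rewrite sumr_const card_ord.
move=> i il; rewrite sum_expr_unity ?mul0r //; first by rewrite exprAC wp expr1n.
rewrite -(prim_order_dvd wP); apply: contra il => /dvdnP[t et].
have : (p + i = t * p + l)%N by rewrite -et addnAC subnK // ltnW.
by move/(congr1 (modn^~ p)); rewrite modnDl modnMDl !modn_small // => il_eq; apply/eqP/val_inj.
Qed.

(** * Natural coefficient families and their rows *)

Definition nsupp n (x : nat -> nat) : nat := \sum_(a < n) (x a != 0%N).

(** Families are functions on [nat] of which only the values below [n] count, so that rows need no
    casts between ordinal types. *)
Definition cyc_eval (F : numFieldType) n (z : F) (x : nat -> nat) : F :=
  \sum_(a < n) (x a)%:R * z ^+ a.

Definition crt_row p n (x : nat -> nat) i : nat -> nat :=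
  fun b => x (crt_index p n i b).

Lemma nsupp_crt p n x : coprime p n ->
  nsupp (p * n) x = (\sum_(i < p) nsupp n (crt_row p n x i))%N.
Proof. by move=> co_pn; rewrite /nsupp (big_crt_index _ (fun a => x a != 0%N : nat) co_pn). Qed.

Lemma nsupp_eq0 n x b : nsupp n x = 0%N -> (b < n)%N -> x b = 0%N.
Proof.
move=> /eqP; rewrite sum_nat_eq0 => /forallP h bn.
by have := h (Ordinal bn); rewrite /= eqb0 negbK => /eqP.
Qed.

Lemma nsuppD n x w : (nsupp n (fun b => x b + w b) <= nsupp n x + nsupp n w)%N.
Proof.
rewrite -big_split leq_sum // => b _.
by case: (x b) (w b) => [|?] [|?].
Qed.

(** All rows of [x - y] have the same value, and row [i] of [x] is zero. Moving row [i] of [y]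
    across keeps the coefficients natural, ready for induction. *)
Lemma cyc_eval_row (F : numFieldType) p n (z : F) x y i l :
    prime p -> coprime p n -> (p * n).-primitive_root z ->
    cyc_eval (p * n) z x = cyc_eval (p * n) z y ->
    (i < p)%N -> (l < p)%N -> nsupp n (crt_row p n x i) = 0%N ->
  cyc_eval n (z ^+ p) (fun b => crt_row p n x l b + crt_row p n y i b)%N =
  cyc_eval n (z ^+ p) (crt_row p n y l).
Proof.
move=> p_pr co_pn zP exy ip lp xi0.
pose d a : int := (x a)%:Z - (y a)%:Z.
have dE a : (d a)%:~R = (x a)%:R - (y a)%:R :> F by rewrite rmorphB.
have sum0 : \sum_(a < p * n) (d a)%:~R * z ^+ a = 0.
  under eq_bigr do rewrite dE mulrBl.
  by rewrite sumrB -/(cyc_eval _ _ x) exy subrr.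
have := row_sum_const p_pr co_pn zP sum0.
pose A j := \sum_(b < n) (d (crt_index p n j b))%:~R * (z ^+ p) ^+ b.
move=> /[dup] /(_ _ ip) Ai /(_ _ lp); rewrite -{}Ai.
have p_neq0 : p%:R != 0 :> F by rewrite pnatr_eq0 -lt0n prime_gt0.
move/(mulfI p_neq0) => Ali; apply/eqP; rewrite -subr_eq0.
have -> : 0 = A l - A i :> F by rewrite /A Ali subrr.
rewrite -!sumrB; apply/eqP/eq_bigr => b _; rewrite -!mulrBl !dE; congr (_ * _).
rewrite /crt_row natrD -[x (crt_index p n i b)]/(crt_row p n x i b).
by rewrite (nsupp_eq0 xi0) // sub0r opprK addrAC.
Qed.

(** * The dichotomy, by induction on the prime factors *)

Lemma nsupp_row_eq0 p n x : coprime p n -> (nsupp (p * n) x < p)%N ->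
  exists i : 'I_p, nsupp n (crt_row p n x i) == 0%N.
Proof.
move=> co_pn; rewrite nsupp_crt // => lt_p; apply/existsP.
apply: contraTT lt_p => /existsPn h; rewrite -leqNgt.
rewrite -{1}[p]card_ord -sum1_card leq_sum // => i _; rewrite lt0n; exact: h.
Qed.

(** Here [e] and [f] are the support sizes of row [l] of [x] and [y], [t] that of the other rows of
    [x], [S] that of [y], and [k] that of [w]. If [p1 - e <= k], the other rows of [y] suffice;
    otherwise row [l] supplies the rest. *)
Lemma dichotomy_arith p1 p q e t f k S :
    (p1 <= q)%N -> (q < p)%N -> (e + t < p1)%N ->
    (k * p.-1 + f <= S + k * t)%N -> ((p1 - (e + k)) * q <= f)%N ->
  ((p1 - (e + t)) * q <= S)%N.
Proof.
move=> p1q qp etp1 hS hf; pose c := (p1 - e)%N.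
have kq : (k * q <= k * p.-1)%N by rewrite leq_mul2l; apply/orP; right; lia.
have [ck | kc] := leqP c k.
  have : (c * (q - t) <= k * (q - t))%N by rewrite leq_mul2r ck orbT.
  have : (t * c <= t * q)%N by rewrite leq_mul2l; apply/orP; right; lia.
  by nia.
have : (k * t <= q * t)%N by rewrite leq_mul2r; apply/orP; right; lia.
by nia.
Qed.

(* The number q stands for p2 - 1. *)
Definition nat_dichotomy (F : numFieldType) p1 q n := forall (z : F) x y,
  n.-primitive_root z -> cyc_eval n z x = cyc_eval n z y -> (nsupp n x < p1)%N ->
  (forall a, (a < n)%N -> (x a <= y a)%N) \/ ((p1 - nsupp n x) * q <= nsupp n y)%N.

(** Rows have length 1, so their values are coefficients: if [x] is zero at [i], each [y l] is
    [x l + y i], and the first alternative holds. *)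
Lemma nat_dichotomy_prime (F : numFieldType) p1 q :
  prime p1 -> nat_dichotomy F p1 q p1.
Proof.
move=> p_pr; rewrite -[X in nat_dichotomy _ _ _ X]muln1 => z x y zP exy xp.
have co1 := coprimen1 p1.
have [i /eqP xi0] := nsupp_row_eq0 co1 xp; left=> a.
case/(crt_index_surj co1) => l [b [lp b0 ->]]; have {b0} -> : b = 0%N by case: b b0.
have := cyc_eval_row p_pr co1 zP exy (ltn_ord i) lp xi0.
rewrite /cyc_eval !big_ord1 !expr0 !mulr1 => /eqP.
by rewrite eqr_nat => /eqP; rewrite /crt_row => <-; apply: leq_addr.
Qed.

Lemma nat_dichotomyM (F : numFieldType) p1 q p n :
    (p1 <= q)%N -> (q < p)%N -> prime p -> coprime p n ->
  nat_dichotomy F p1 q n -> nat_dichotomy F p1 q (p * n).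
Proof.
move=> p1q qp p_pr co_pn IH z x y zP exy xp1.
have [i0 xi0] := nsupp_row_eq0 co_pn (ltn_trans xp1 (leq_ltn_trans p1q qp)).
pose e i := nsupp n (crt_row p n x i); pose f i := nsupp n (crt_row p n y i).
have [j /eqP ej0 jmin] := @arg_minnP _ i0
  (fun i : 'I_p => nsupp n (crt_row p n x i) == 0%N) (fun i => f i) xi0.
pose X i := fun b => (crt_row p n x i b + crt_row p n y j b)%N.
have zpP : n.-primitive_root (z ^+ p).
  have := dvdn_prim_root zP (dvdn_mull p (dvdnn n)); rewrite mulnK //.
  by have := prim_order_gt0 zP; rewrite muln_gt0 => /andP[].
have eX (l : 'I_p) : cyc_eval n (z ^+ p) (X l) = cyc_eval n (z ^+ p) (crt_row p n y l).
  exact: cyc_eval_row.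
have sX (l : 'I_p) : (nsupp n (X l) <= e l + f j)%N by apply: nsuppD.
have bound (l : 'I_p) : ((p1 - (e l + f j)) * q <= f l)%N ->
    ((p1 - nsupp (p * n) x) * q <= nsupp (p * n) y)%N.
  rewrite !nsupp_crt // in xp1 *; rewrite (bigD1 l) //= -/(e l) in xp1 *.
  apply: (dichotomy_arith (k := f j) p1q qp xp1).
  rewrite [X in (_ <= X + _)%N](bigD1 l) //= -/(f l) addnC -addnA leq_add2l.
  have -> : p.-1 = #|predC1 l| by rewrite cardC1 card_ord.
  rewrite mulnC -sum_nat_const big_distrr -big_split /= leq_sum // => i _.
  (* [f j <= f i + f j * e i]: by minimality of [j] when row [i] of [x] is zero, and since
     [e i >= 1] otherwise. *)
  have [ei0|] := eqVneq (nsupp n (crt_row p n x i)) 0%N.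
    by apply: leq_trans (leq_addr _ _); apply: jmin; rewrite ei0.
  by rewrite -lt0n => e_gt0; rewrite (leq_trans (leq_pmulr _ e_gt0)) ?leq_addl.
have [/existsP[l big_l] | /existsPn small] := boolP [exists l : 'I_p, p1 <= e l + f j]%N.
  (* Truncated subtraction makes the hypothesis of [bound] trivial. *)
  by right; apply: (bound l); move: big_l; rewrite -subn_eq0 => /eqP ->.
have [/existsP[l fl] | /existsPn le_f] :=
    boolP [exists l : 'I_p, (p1 - nsupp n (X l)) * q <= nsupp n (crt_row p n y l)]%N.
  by right; apply: (bound l); rewrite (leq_trans _ fl) // leq_mul2r leq_sub2l ?orbT.
left=> a /(crt_index_surj co_pn)[l [b [lp bn ->]]].
have Xp1 : (nsupp n (X l) < p1)%N.
  by have := small (Ordinal lp); rewrite -ltnNge; apply/leq_ltn_trans/(sX (Ordinal lp)).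
have [/(_ b bn) le_xy | ] := IH _ _ _ zpP (eX (Ordinal lp)) Xp1.
  by apply: leq_trans le_xy; apply: leq_addr.
by have /negP := le_f (Ordinal lp).
Qed.

(** The primes of [s] may be peeled off in any order, as each step only compares them with [q]. *)
Lemma nat_dichotomy_prod (F : numFieldType) p1 q (s : seq nat) :
    prime p1 -> (p1 <= q)%N -> all prime s -> all (ltn q) s -> uniq s ->
  nat_dichotomy F p1 q (p1 * \prod_(l <- s) l).
Proof.
move=> p1_pr p1q; elim: s => [|p s IHs] /=.
  by rewrite big_nil muln1; move=> _ _ _; apply: nat_dichotomy_prime.
move=> /andP[p_pr s_pr] /andP[qp qs] /andP[p_s s_uniq].
rewrite big_cons mulnCA; apply: nat_dichotomyM => //; last exact: IHs.
rewrite coprimeMr prime_coprime // dvdn_prime2 //.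
rewrite [_ == _]gtn_eqF ?(leq_ltn_trans p1q) //=.
rewrite big_seq; elim/big_rec: _ => [|l m ls co_pm]; first exact: coprimen1.
rewrite coprimeMr co_pm andbT prime_coprime // dvdn_prime2 ?(allP s_pr l ls) //.
by apply: contraNneq p_s => ->.
Qed.

(** * Transfer to the group ring *)

Theorem theorem4p1
  (R : realType) (r : nat) (p : r.-tuple nat)
  (r_ge2 : (2 <= r)%N)
  (p_prime : forall q : nat, q \in p -> prime q)
  (p_incr : sorted ltn p)
  (gT : finGroupType)
  (gT_order : #|[set: gT]| = (\prod_(q <- p) q)%N)
  (z : gT) (z_gen : generator [set: gT] z)
  (zeta : R[i]) (zeta_prim : (\prod_(q <- p) q)%N.-primitive_root zeta)
  (phi : {rmorphism int_gring gT -> R[i]})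
  (phi_z : phi (gr_elt z) = zeta)
  (x y : int_gring gT) (x_nat : gr_nat x) (y_nat : gr_nat y)
  (phi_xy : phi x = phi y)
  (p1 := nth 0%N p 0) (p2 := nth 0%N p 1)
  (x_eps : (gr_eps0 x <= p1 - 1)%N) :
  [/\ gr_le x y \/ ((p1 - gr_eps0 x) * (p2 - 1) <= gr_eps0 y)%N,
      gr_le x y -> (gr_eps0 x <= gr_eps0 y)%N
    & ((p1 - gr_eps0 x) * (p2 - 1) <= gr_eps0 y)%N ->
      (gr_eps0 x < gr_eps0 y)%N].
Proof.
have [s p_eq] : exists s, p = [:: p1, p2 & s] :> seq nat.
  rewrite /p1 /p2; have := size_tuple p; case: (tval p) => [|a [|b s]] /= sp.
  - by rewrite -sp in r_ge2.
  - by rewrite -sp in r_ge2.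
  by exists s.
have p1_pr : prime p1 by apply: p_prime; rewrite memtE p_eq mem_head.
move: (p_incr); rewrite p_eq /= => /andP[p12 /order_path_min].
move=> /(_ ltn_trans) p2_min.
have p_uniq : uniq p by apply: sorted_uniq p_incr; [exact: ltn_trans|exact: ltnn].
have p1_gt0 := prime_gt0 p1_pr.
have x_lt : (gr_eps0 x < p1)%N by rewrite -(subnK p1_gt0) addn1 ltnS.
split; last first.
(* The factor [p1 - gr_eps0 x] is at least 1, and [p2 - 1 >= p1 > gr_eps0 x]. *)
- apply: leq_trans; apply: (@leq_trans (p2 - 1)).
    by rewrite (leq_trans x_lt) // -ltnS subn1 prednK // (leq_trans _ p12).
  by rewrite leq_pmull // subn_gt0.
- move=> le_xy; apply/subset_leq_card/subsetP => g; rewrite !inE => xg.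
  by rewrite gt_eqF // (lt_le_trans _ (le_xy g)) // lt_def xg x_nat.
set m := (\prod_(q <- p) q)%N in gT_order zeta_prim.
have oz : #[z]%g = m by move: z_gen; rewrite /generator => /eqP e; rewrite /order -e.
(* [absz] always preserves the support, and on [gr_nat] elements the coefficients too. *)
pose c (u : int_gring gT) a := absz (gr_coef u (z ^+ a)%g).
have zE g : exists2 a, (a < m)%N & g = (z ^+ a)%g.
  move: z_gen; rewrite /generator => /eqP e; have : g \in <[z]>%g by rewrite -e inE.
  by case/cyclePmin => a; rewrite oz => am ->; exists a.
have big_z (S : Type) (idx : S) (op : Monoid.com_law idx) (f : gT -> S) :
    \big[op/idx]_g f g = \big[op/idx]_(a < m) f (z ^+ a)%g.
  rewrite (reindex (fun a : 'I_m => (z ^+ a)%g)) //=; apply/onW_bij/inj_card_bij.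
    by move=> a b /eqP; rewrite eq_expg_mod_order oz !modn_small // => /eqP/val_inj.
  by rewrite card_ord -gT_order cardsT.
have epsE u : gr_eps0 u = nsupp m (c u).
  rewrite /gr_eps0 -sum1_card big_mkcond big_z; apply: eq_bigr => a _.
  by rewrite inE -absz_eq0; case: eqP.
have phiX a : phi (gr_elt (z ^+ a)%g) = zeta ^+ a.
  elim: a => [|a IHa]; first by rewrite expr0 -[RHS](rmorph1 phi).
  rewrite exprS -IHa -phi_z -rmorphM; congr (phi _).
  apply: gr_coefP => g; rewrite gr_coef_mul (bigD1 z) //= big1 ?addr0 => [|h hz].
    by rewrite !gr_coef_elt eqxx mul1r expgS -[in RHS](inj_eq (mulgI z)) mulKVg.
  by rewrite !gr_coef_elt (negPf hz) mul0r.
have coefMn (u : int_gring gT) n g : gr_coef (u *+ n) g = gr_coef u g *+ n.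
  by elim: n => [|n IHn]; rewrite ?mulrS ?gr_coefD ?IHn // /gr_coef ffunE.
have phiE u : gr_nat u -> phi u = cyc_eval m zeta (c u).
  move=> u_nat; have uE : u = \sum_(a < m) gr_elt (z ^+ a)%g *+ c u a.
    rewrite -(big_z _ _ _ (fun g => gr_elt g *+ absz (gr_coef u g))).
    apply: gr_coefP => g.
    have coef0 : gr_coef 0 g = 0 by rewrite /gr_coef ffunE.
    rewrite (big_morph (fun v => gr_coef v g) (fun v w => gr_coefD v w g) coef0).
    rewrite (bigD1 g) //= big1 ?addr0 => [|h hg].
      by rewrite coefMn gr_coef_elt eqxx -mulrnA mul1n natz gez0_abs.
    by rewrite coefMn gr_coef_elt eq_sym (negPf hg) mul0rn.
  rewrite {1}uE rmorph_sum; apply: eq_bigr => a _.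
  by rewrite rmorphMn phiX mulr_natl.
have exy : cyc_eval m zeta (c x) = cyc_eval m zeta (c y) by rewrite -!phiE.
have dich : nat_dichotomy R[i] p1 (p2 - 1) m.
  rewrite /m p_eq big_cons.
  move: p_uniq; rewrite p_eq => /= /andP[_ s_uniq].
  have p2_gt0 : (0 < p2)%N by apply: leq_ltn_trans p12.
  (* [q = p2 - 1] is at least [p1] and lies strictly below every peeled prime, [p2] included. *)
  apply: nat_dichotomy_prod => //.
  - by rewrite -ltnS subn1 prednK.
  - by apply/allP => l ls; apply: p_prime; rewrite memtE p_eq in_cons ls orbT.
  apply/allP => l; rewrite in_cons /= -ltnS subn1 prednK // => /predU1P[-> //|ls].
  by apply/ltnW; have /allP := p2_min; apply.
have := dich _ _ _ zeta_prim exy; rewrite -!epsE => /(_ x_lt)[le_xy|]; last by right.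
left=> g; have [a am ->] := zE g.
rewrite -[gr_coef x _]gez0_abs ?x_nat // -[gr_coef y _]gez0_abs ?y_nat //.
exact: le_xy.
Qed.
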